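(* Let $c_E$ be the constant defined in the context and let $L$ be a standard Laplace random variable (density $\frac12e^{-|x|}$ on $\mathbb{R}$). Let $X$ be an integrable real random variable with $\mathbb{E}[X]=0$ and $$\mathbb{P}(|X|>t)\le\min\{1,2e^{-t}\}\qquad\text{for all }t\ge0.$$ Then $X\preceq_{cx}c_EL$. Moreover, $c_E$ is optimal: for every $c$ with $0<c<c_E$ there exists an integrable mean-zero real random variable $X$ satisfying the same tail bound but with $X\not\preceq_{cx}cL$.
   Context: Convex domination: for integrable real random variables, $X\preceq_{cx}Y$ means $\mathbb{E}[f(X)]\le\mathbb{E}[f(Y)]$ for every convex $f:\mathbb{R}\to\mathbb{R}$ for which both expectations are finite. Let $s_E(t)=\min\{1,2e^{-t}\}$ for $t\ge0$, $A_E=\int_0^\infty s_E(t)\,\mathrm{d}t$, $B_E=A_E/2$ (so $B_E=(1+\log2)/2$), and $H_E(x)=x\,s_E(x)+\int_x^\infty s_E(t)\,\mathrm{d}t$. Let $a_E>0$ satisfy $H_E(a_E)=B_E$ (such $a_E$ exists and is unique, and $a_E>2\log2$), and set $p_E=s_E(a_E)=2e^{-a_E}$. Define $$w_E=\log\frac{1}{2p_E},\qquad c_E=\frac{B_E}{p_E(1+w_E)}.$$ *)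

(* Defs.v *)
From HB Require Import structures.
From mathcomp Require Import all_boot all_order all_algebra.
From mathcomp Require Import all_classical all_reals all_analysis.
Set Implicit Arguments.
Unset Strict Implicit.
Unset Printing Implicit Defensive.
Import Order.TTheory GRing.Theory Num.Theory.
Import numFieldNormedType.Exports.
Local Open Scope classical_set_scope.
Local Open Scope ring_scope.

(* X and Y may live on different probability spaces. "Finite expectation" is
   integrability; a convex f on the line is continuous, so it raises no
   measurability condition. *)
Definition cx_le (R : realType) d (T : measurableType d) (P : probability T R)
    d' (T' : measurableType d') (P' : probability T' R)
    (X : T -> R) (Y : T' -> R) : Prop :=
  forall f : R -> R, convex_function (setT : set R^o) f ->
    P.-integrable [set: T] (EFin \o (f \o X)) ->
    P'.-integrable [set: T'] (EFin \o (f \o Y)) ->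
    ('E_P[f \o X] <= 'E_P'[f \o Y])%E.

Definition laplace_pdf (R : realType) (x : R) : R := 2^-1 * expR (- `|x|).

Definition standard_laplace (R : realType) d (T : measurableType d)
    (P : probability T R) (L : {RV P >-> R}) : Prop :=
  forall A : set R, measurable A ->
    distribution P L A =
      (\int[@lebesgue_measure R]_(x in A) (laplace_pdf x)%:E)%E.

Section constants.
Variable R : realType.
Local Notation mu := (@lebesgue_measure R).

(* Only used for 0 <= t. *)
Definition s_E (t : R) : R := Num.min 1 (2 * expR (- t)).

Definition A_E : R := \int[mu]_(t in `[0, +oo[) s_E t.

Definition B_E : R := A_E / 2.

Definition H_E (x : R) : R := x * s_E x + \int[mu]_(t in `[x, +oo[) s_E t.

(* H_E is constant equal to A_E on [0, ln 2] and decreases strictly from A_E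
   to 0 on [ln 2, +oo[, so exactly one a meets this specification. *)
Definition a_E : R := [get a : R | 0 < a /\ H_E a = B_E].

Definition p_E : R := s_E a_E.

Definition w_E : R := ln (1 / (2 * p_E)).

Definition c_E : R := B_E / (p_E * (1 + w_E)).

End constants.


Definition centered_with_E_tail (R : realType) d (T : measurableType d)
    (P : probability T R) (X : {RV P >-> R}) : Prop :=
  [/\ P.-integrable [set: T] (EFin \o X),
      ('E_P[X] = 0)%E &
      forall t : R, 0 <= t -> (P [set w | (t < `|X w|)%R] <= (s_E t)%:E)%E].

(* Main.v *)
(* Convex order between centred variables is tested on the stop-loss functions
   E(X - u)+ and E(-X - u)+, u >= 0: up to an affine function, a convex f is
   g1(x) + g2(-x) with g1, g2 convex, nondecreasing and zero on the negative
   half-line, and such a g is the pointwise limit from below of nonnegative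
   combinations of hinges (x - u)+.

   Write a, p, B, w, c for a_E, p_E, B_E, w_E, c_E. The tail bound gives
   E(X - u)+ <= 2 exp(-u), and together with E X+ = E|X| / 2 <= B it gives
   E(X - u)+ <= B - p u for u <= a. The Laplace stop-loss (c/2) exp(-u/c) is
   convex in u and B - p u is its tangent at u = c w, which settles u <= a; for
   u >= a it decays more slowly than 2 exp(-u) since c >= 1. For optimality,
   the variable of modulus ln 2 + |L|, positive exactly when that modulus
   exceeds a, attains B - p u at the tangency point u = c w. *)
Require Import Defs.
From HB Require Import structures.
From mathcomp Require Import all_boot all_order all_algebra.
From mathcomp Require Import all_classical all_reals all_analysis.
From mathcomp Require Import measurable_realfun ring lra.
Set Implicit Arguments.
Unset Strict Implicit.
Unset Printing Implicit Defensive.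
Import Order.TTheory GRing.Theory Num.Theory.
Import numFieldNormedType.Exports.
Local Open Scope classical_set_scope.
Local Open Scope ring_scope.

(** * Hinge approximation of convex functions *)

Section convex_line.
Context {R : realType}.
Implicit Types (f g : R -> R) (x y z h : R).

Lemma convex_function_le f (t x y : R) : convex_function (setT : set R^o) f ->
  0 <= t -> t <= 1 ->
  f (t * x + (1 - t) * y) <= t * f x + (1 - t) * f y.
Proof.
move=> cf t0 t1; exact: (cf (@Itv01 _ _ t0 t1) x y (in_setT _) (in_setT _)).
Qed.

(** The chord inequality cleared of denominators, which keeps the degenerate case [x = z] true and
    makes later uses linear or polynomial arithmetic. *)
Lemma convex_three_points f x y z : convex_function (setT : set R^o) f ->
  x <= y -> y <= z -> (z - x) * f y <= (z - y) * f x + (y - x) * f z.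
Proof.
move=> cf xy yz.
have [xz|xz] := eqVneq x z.
  by have -> : y = x by [lra]; subst z; lra.
have xz0 : 0 < z - x by rewrite subr_gt0 lt_neqAle xz (le_trans xy).
have t01 : 0 <= (z - y) / (z - x) <= 1.
  by rewrite divr_ge0 ?subr_ge0 ?(le_trans xy)//= ler_pdivrMr// mul1r lerD2l lerN2.
have /andP[t0 t1] := t01.
have := convex_function_le x z cf t0 t1.
have -> : (z - y) / (z - x) * x + (1 - (z - y) / (z - x)) * z = y.
  by field; rewrite gt_eqF.
rewrite -(ler_pM2l xz0); congr (_ <= _).
by field; rewrite gt_eqF.
Qed.

Lemma convex_functionI f :
  (forall t x y, 0 <= t -> t <= 1 ->
    f (t * x + (1 - t) * y) <= t * f x + (1 - t) * f y) ->
  convex_function (setT : set R^o) f.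
Proof. by move=> H t x y _ _; rewrite !convRE; apply: H. Qed.

(** Jump of slope at the node [h * i] of the piecewise linear interpolant of [g] with mesh [h]. The
    left neighbour is computed in [R], so for [i = 0] it is the point [- h] and not a truncated
    0. *)
Definition second_difference g h (i : nat) : R :=
  (g (h * i.+1%:R) - 2 * g (h * i%:R) + g (h * (i%:R - 1))) / h.

(** The slope jump found at [h * i] is placed at [h * i.+1]: this delay by one step is what keeps
    the sum below a nondecreasing [g]. *)
Definition hinge_sum g h (N : nat) x : R :=
  \sum_(i < N) second_difference g h i * Num.max (x - h * i.+1%:R) 0.

Variables (g : R -> R) (h : R).
Hypotheses (cg : convex_function (setT : set R^o) g).
Hypothesis ndg : {homo g : x y / x <= y}.
Hypothesis g0 : forall x, x <= 0 -> g x = 0.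
Hypothesis h0 : 0 < h.

Lemma second_difference_ge0 i : 0 <= second_difference g h i.
Proof.
rewrite divr_ge0 ?(ltW h0)//.
have := @convex_three_points g (h * (i%:R - 1)) (h * i%:R) (h * i.+1%:R) cg.
rewrite -natr1 !ler_pM2l// => /(_ ltac:(lra) ltac:(lra)).
have -> : (h * (i%:R + 1) - h * (i%:R - 1)) = h * 2 by ring.
have -> : (h * (i%:R + 1) - h * i%:R) = h by ring.
have -> : (h * i%:R - h * (i%:R - 1)) = h by ring.
by rewrite -mulrA -mulrDr ler_pM2l//; lra.
Qed.

Let term_ge0 i x : 0 <= second_difference g h i * Num.max (x - h * i.+1%:R) 0.
Proof. by rewrite mulr_ge0 ?second_difference_ge0// le_max lexx orbT. Qed.

Lemma hinge_sum_ge0 N x : 0 <= hinge_sum g h N x.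
Proof. by apply: sumr_ge0 => i _. Qed.

(** Slope jumps telescope, and the initial slope vanishes because [g] is zero at [0] and [- h]. *)
Lemma sum_second_difference k :
  h * \sum_(i < k) second_difference g h i =
  g (h * k%:R) - g (h * (k%:R - 1)).
Proof.
elim: k => [|k IH].
  by rewrite big_ord0 !mulr0 sub0r mulrN1 !g0 ?subrr// oppr_le0 ltW.
rewrite big_ord_recr/= mulrDr IH /second_difference -natr1 addrK.
by field; rewrite gt_eqF.
Qed.

(* On the grid the hinge sum interpolates [g] shifted by one step. *)
Lemma hinge_sum_grid N k : (k <= N)%N ->
  hinge_sum g h N (h * k.+1%:R) = g (h * k%:R).
Proof.
move=> kN.
(* At this node the hinges of index at least [k] vanish, and the others are on their linear
   branch. *)
have -> : hinge_sum g h N (h * k.+1%:R) =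
    \sum_(i < k) second_difference g h i * (h * (k%:R - i%:R)).
  rewrite /hinge_sum -(big_mkord xpredT (fun i => second_difference g h i *
    Num.max (h * k.+1%:R - h * i.+1%:R) 0)).
  rewrite -(big_mkord xpredT (fun i => second_difference g h i *
    (h * (k%:R - i%:R)))).
  rewrite (big_cat_nat (n := k))//=.
  rewrite [X in _ + X = _](_ : _ = 0) ?addr0; last first.
    rewrite big_nat big1// => i /andP[ki _]; rewrite max_r ?mulr0//.
    by rewrite -mulrBr pmulr_rle0// subr_le0 ler_nat ltnS.
  rewrite big_nat [RHS]big_nat; apply: eq_bigr => i /andP[_ ik].
  rewrite max_l -!natr1; last first.
    by rewrite -mulrBr mulr_ge0 ?(ltW h0)// subr_ge0 lerD2r ler_nat ltnW.
  by congr (_ * _); ring.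
elim: k {kN} => [|k IH]; first by rewrite big_ord0 mulr0 g0.
rewrite big_ord_recr/=.
(* Moving one node to the right adds [h] times the accumulated slope, known from the telescoping
   sum. *)
have -> : \sum_(i < k) second_difference g h i * (h * (k.+1%:R - i%:R)) =
    \sum_(i < k) second_difference g h i * (h * (k%:R - i%:R)) +
    h * \sum_(i < k) second_difference g h i.
  rewrite mulr_sumr -big_split/=; apply: eq_bigr => i _.
  by rewrite -natr1; ring.
rewrite IH sum_second_difference /second_difference -!natr1.
by field; rewrite gt_eqF.
Qed.

Lemma hinge_sum_homo N : {homo hinge_sum g h N : x y / x <= y}.
Proof.
move=> x y xy; apply: ler_sum => i _.
apply: ler_wpM2l; first exact: second_difference_ge0.
by rewrite ge_max !le_max lerD2r xy lexx/= orbT.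
Qed.

Lemma hinge_sum_leN N M x : (N <= M)%N -> hinge_sum g h N x <= hinge_sum g h M x.
Proof.
move=> NM; rewrite /hinge_sum.
rewrite -!(big_mkord xpredT (fun i => second_difference g h i *
  Num.max (x - h * i.+1%:R) 0)).
by rewrite [leRHS](big_cat_nat (n := N))//= lerDl sumr_ge0.
Qed.

Lemma grid_cell x : h <= x ->
  exists k : nat, h * k.+1%:R <= x < h * k.+2%:R.
Proof.
move=> hx.
have xh0 : 0 <= (x - h) / h by rewrite divr_ge0 ?subr_ge0// ltW.
have := truncn_itv xh0; set k := Num.trunc _ => /andP[].
rewrite ler_pdivlMr// ltr_pdivrMr// => k1 k2; exists k; rewrite -!natr1.
rewrite -natr1 in k2.
by apply/andP; split; lra.
Qed.

Lemma hinge_sum_le N x : hinge_sum g h N x <= g x.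
Proof.
have [xh|/ltW hx] := leP x h.
  rewrite /hinge_sum big1 => [|i _].
    by have [/g0->//|/ltW/ndg] := leP x 0; rewrite g0.
  rewrite max_r ?mulr0// subr_le0 (le_trans xh)// ler_peMr ?(ltW h0)//.
  by rewrite ler1n.
have [k /andP[k1 k2]] := grid_cell hx.
rewrite (le_trans (hinge_sum_homo _ (ltW k2)))//.
(* Extra hinges only increase the sum; with at least [k.+1] of them the grid formula holds at the
   right end of the cell. *)
rewrite (le_trans (hinge_sum_leN _ (leq_maxl N k.+1)))//.
by rewrite hinge_sum_grid ?leq_maxr// ndg.
Qed.

(** One [h] is lost to the delay of the hinges and one to rounding [x] down to a node. *)
Lemma le_hinge_sum N x : x <= h * N.+1%:R -> g (x - 2 * h) <= hinge_sum g h N x.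
Proof.
move=> xN.
have [xh|/ltW hx] := leP x h.
  by rewrite g0 ?hinge_sum_ge0//; have := h0; lra.
have [k /andP[k1 k2]] := grid_cell hx.
have kN : (k <= N)%N.
  by have := le_trans k1 xN; rewrite ler_pM2l// ler_nat ltnS.
apply: le_trans (hinge_sum_homo _ k1).
rewrite hinge_sum_grid// ndg//.
by move: k2; rewrite -!natr1; lra.
Qed.

End convex_line.

(** With mesh [1 / (n + 1)] and [(n + 1) ^ 2] hinges the grid is refined and its range grows beyond
    [n + 1], so the two-sided bounds eventually apply at any fixed [x]. *)
Lemma cvg_hinge_sum (R : realType) (g : R -> R) (x : R) :
  convex_function (setT : set R^o) g -> {homo g : x y / x <= y} ->
  (forall x, x <= 0 -> g x = 0) ->
  hinge_sum g n.+1%:R^-1 (n.+1 ^ 2) x @[n --> \oo] --> g x.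
Proof.
move=> cg ndg g0.
pose D := g (x + 1) - g x.
(* The chord from [x - t] to [x + 1] lies above [g] at [x]; this gives left-continuity at a linear
   rate. *)
have lo (t : R) : 0 <= t -> g x - t * D <= g (x - t).
  move=> t0.
  have := @convex_three_points R g (x - t) x (x + 1) cg ltac:(lra) ltac:(lra).
  by rewrite /D; nra.
have harm : n.+1%:R^-1 @[n --> \oo] --> (0 : R) by exact: cvg_harmonic.
apply: (@squeeze_cvgr _ _ _ _ (fun n => g x - 2 * n.+1%:R^-1 * D) (cst (g x))).
- near=> n.
  have n0 : 0 < n.+1%:R^-1 :> R by rewrite invr_gt0.
  apply/andP; split; last exact: hinge_sum_le.
  have t0 : 0 <= 2 * n.+1%:R^-1 :> R by rewrite mulr_ge0// ltW.
  rewrite (le_trans (lo _ t0))// le_hinge_sum//.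
  rewrite ler_pdivlMl// -(natr1 (n.+1 ^ 2)) natrX.
  have xn : x <= n%:R by near: n; exact: nbhs_infty_ger.
  rewrite -natr1.
  have : 0 <= n%:R :> R by [].
  by nra.
- rewrite -[X in _ --> X]subr0 -[X in _ - X](mul0r D) -[X in X * D](mulr0 2).
  by apply: cvgB; [exact: cvg_cst|apply: cvgMl; apply: cvgMr].
- exact: cvg_cst.
Unshelve. all: by end_near. Qed.

(** * Stop-loss values and integrals of hinge sums *)

Section stop_loss.
Context {R : realType} d (T : measurableType d) (P : probability T R).
Implicit Types X : T -> R.

Definition stop_loss X (u : R) : \bar R :=
  (\int[P]_w (Num.max (X w - u) 0)%:E)%E.

Lemma measurable_hinge X u : measurable_fun setT X ->
  measurable_fun setT (fun w => (Num.max (X w - u) 0)%:E).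
Proof.
move=> mX; apply/measurable_EFinP; apply: measurable_maxr => //.
exact: measurable_funB.
Qed.

Lemma hinge_ge0 (X : T -> R) u w : (0 <= (Num.max (X w - u) 0)%:E)%E.
Proof. by rewrite lee_fin le_max lexx orbT. Qed.

Lemma stop_loss_ge0 X u : (0 <= stop_loss X u)%E.
Proof. by apply: integral_ge0 => w _; exact: hinge_ge0. Qed.

Lemma measurable_hinge_sum (g : R -> R) (h : R) N X : measurable_fun setT X ->
  measurable_fun setT (fun w => (hinge_sum g h N (X w))%:E).
Proof.
move=> mX; apply/measurable_EFinP; rewrite /hinge_sum.
apply: measurable_sum => i; apply: measurable_funM => //.
exact/measurable_EFinP/measurable_hinge.
Qed.

Lemma integral_hinge_sum (g : R -> R) (h : R) N X :
  (forall i, 0 <= second_difference g h i) -> measurable_fun setT X ->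
  (\int[P]_w (hinge_sum g h N (X w))%:E =
   \sum_(i < N) (second_difference g h i)%:E * stop_loss X (h * i.+1%:R))%E.
Proof.
move=> g0 mX.
under eq_integral do rewrite /hinge_sum -sumEFin.
rewrite ge0_integral_sum//=.
- apply: eq_bigr => i _; rewrite /stop_loss -ge0_integralZl_EFin//.
  + by move=> w _; exact: hinge_ge0.
  + exact: measurable_hinge.
- move=> i; under eq_fun do rewrite EFinM.
  by apply: emeasurable_funM => //; exact: measurable_hinge.
- move=> i w _; rewrite EFinM mule_ge0//; first by rewrite lee_fin.
  exact: hinge_ge0.
Qed.

End stop_loss.

(** The grids are not nested, so Fatou's lemma replaces monotone convergence on the [X] side; on the
    [Y] side every hinge sum is dominated by [g]. *)
Lemma le_integral_monotone_convex (R : realType)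
    d (T : measurableType d) (P : probability T R)
    d' (T' : measurableType d') (P' : probability T' R)
    (X : T -> R) (Y : T' -> R) (g : R -> R) :
  convex_function (setT : set R^o) g -> {homo g : x y / x <= y} ->
  (forall x, x <= 0 -> g x = 0) ->
  measurable_fun setT X -> measurable_fun setT Y ->
  (forall u, 0 <= u -> (stop_loss P X u <= stop_loss P' Y u)%E) ->
  (\int[P]_w (g (X w))%:E <= \int[P']_w (g (Y w))%:E)%E.
Proof.
move=> cg ndg g0 mX mY XY.
pose F n := hinge_sum g n.+1%:R^-1 (n.+1 ^ 2).
have n0 n : 0 < n.+1%:R^-1 :> R by rewrite invr_gt0.
have F0 n x : 0 <= F n x by exact: hinge_sum_ge0.
have mg : measurable_fun setT g by exact: nondecreasing_measurable.
have -> : (\int[P]_w (g (X w))%:E =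
    \int[P]_w limn_einf (fun n => (F n (X w))%:E))%E.
  apply: eq_integral => w _; apply/esym.
  have /cvg_limn_einf_sup[]// : (F n (X w))%:E @[n --> \oo] --> (g (X w))%:E.
  by apply: cvg_EFin; [exact: nearW|exact: cvg_hinge_sum].
apply: (@le_trans _ _ (limn_einf (fun n => \int[P]_w (F n (X w))%:E)%E)).
  apply: (@fatou _ _ _ P _ measurableT (fun n w => (F n (X w))%:E)) => //.
  by move=> n; exact: measurable_hinge_sum.
  by move=> n w _; rewrite lee_fin.
have FY n : (\int[P]_w (F n (X w))%:E <= \int[P']_w (g (Y w))%:E)%E.
  apply: (@le_trans _ _ (\int[P']_w (F n (Y w))%:E)%E).
    have sd0 i := @second_difference_ge0 R g _ cg (n0 n) i.
    rewrite !integral_hinge_sum//; apply: lee_sum => i _.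
    by rewrite lee_wpmul2l// ?lee_fin// XY// mulr_ge0// ltW.
  apply: ge0_le_integral => //.
  - by move=> w _; rewrite lee_fin.
  - exact: measurable_hinge_sum.
  - by apply/measurable_EFinP; exact: measurableT_comp.
  - by move=> w _; rewrite lee_fin; exact: hinge_sum_le.
rewrite limn_einf_lim; apply: lime_le.
  exact: is_cvg_einfs.
apply: nearW => n; apply: ereal_inf_le => /=.
by exists (\int[P]_w (F n (X w))%:E)%E => //; exists n => /=.
Qed.

(** * Splitting a convex function at 0 and reduction to stop-loss functions *)

Lemma convex_subgradient0 (R : realType) (f : R -> R) :
  convex_function (setT : set R^o) f ->
  exists m, forall x, f 0 + m * x <= f x.
Proof.
move=> cf.
(* The slope is the supremum of the backward difference quotients at 0; each forward quotient is an
   upper bound. *)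
pose S := [set (f 0 - f (- y)) / y | y in [set y : R | 0 < y]].
have ubS x : 0 < x -> ubound S ((f x - f 0) / x).
  move=> x0 _ [y /= y0 <-]; rewrite ler_pdivrMr// mulrAC ler_pdivlMr//.
  by have := @convex_three_points R f (- y) 0 x cf ltac:(lra) ltac:(lra); lra.
have S0 : S !=set0 by exists ((f 0 - f (- 1)) / 1); exists 1 => /=.
exists (sup S) => x; case: (ltgtP 0 x) => [x0|x0|<-].
- have := ge_sup S0 (ubS _ x0).
  by rewrite ler_pdivlMr//; lra.
- have : (f 0 - f x) / (- x) <= sup S.
    apply: (ub_le_sup (E := S)); first by exists ((f 1 - f 0) / 1); exact: ubS.
    by exists (- x) => /=; rewrite ?opprK// oppr_gt0.
  by rewrite ler_pdivrMr ?oppr_gt0//; lra.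
- by rewrite mulr0 addr0.
Qed.

Section convex_positive_part.
Context {R : realType} (g : R -> R).
Hypotheses (cg : convex_function (setT : set R^o) g).
Hypothesis (gge0 : forall x, 0 <= g x) (g0 : g 0 = 0).

Let gp x := g (Num.max x 0).

(** A convex function with minimum at 0 increases to the right of 0. *)
Let g_homo x y : 0 <= x -> x <= y -> g x <= g y.
Proof.
move=> x0 xy; have [y00|y0] := eqVneq y 0.
  by rewrite (_ : x = y)//; lra.
have yp : 0 < y by rewrite lt_neqAle eq_sym y0 (le_trans x0).
have := convex_three_points cg x0 xy; rewrite g0 => H.
rewrite -(ler_pM2l yp); have := gge0 y; nra.
Qed.

Lemma positive_part_homo : {homo gp : x y / x <= y}.
Proof.
by move=> x y xy; apply: g_homo; rewrite /gp ?ge_max !le_max ?xy ?lexx ?orbT.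
Qed.

Lemma positive_part_le0 x : x <= 0 -> gp x = 0.
Proof. by move=> x0; rewrite /gp max_r. Qed.

Lemma positive_part_convex : convex_function (setT : set R^o) gp.
Proof.
apply: convex_functionI => t x y t0 t1; rewrite /gp.
apply: le_trans (convex_function_le _ _ cg t0 t1); apply: g_homo.
  by rewrite le_max lexx orbT.
have [x0 y0] : Num.max x 0 >= 0 /\ Num.max y 0 >= 0.
  by rewrite !le_max !lexx !orbT.
have [x1 y1] : Num.max x 0 >= x /\ Num.max y 0 >= y.
  by rewrite !le_max !lexx.
rewrite ge_max; apply/andP; split.
  by apply: lerD; apply: ler_wpM2l => //; rewrite subr_ge0.
by apply: addr_ge0; apply: mulr_ge0 => //; rewrite subr_ge0.
Qed.

End convex_positive_part.

(** The mean of [X] removes the linear term, and [g 0 = 0] lets [g (X w)] be written as the sum of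
    its values at the positive part and at minus the negative part. Both integrands are
    nonnegative. *)
Lemma integral_convex_split (R : realType) d (T : measurableType d)
    (P : probability T R) (f : R -> R) (m : R) (X : T -> R) :
  let g x := f x - (f 0 + m * x) in
  measurable_fun setT (g \o X) -> (forall x, 0 <= g x) ->
  measurable_fun [set: R] (fun x : R => g (Num.max x 0)) ->
  measurable_fun [set: R] (fun x : R => g (- Num.max x 0)) ->
  P.-integrable setT (EFin \o X) -> (\int[P]_w (X w)%:E = 0)%E ->
  P.-integrable setT (EFin \o (f \o X)) ->
  ('E_P[f \o X] = (f 0)%:E + (\int[P]_w (g (Num.max (X w) 0))%:E +
     \int[P]_w (g (- Num.max (- X w) 0))%:E))%E.
Proof.
move=> g mgX gge0 mgp mgm iX EX ifX.
have mX : measurable_fun setT X by apply/measurable_EFinP; apply: measurable_int iX.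
have icst : P.-integrable setT (EFin \o cst (f 0)).
  exact: finite_measure_integrable_cst.
have imX : P.-integrable setT (fun w => (m%:E * (X w)%:E)%E).
  exact: integrableZl.
have il := integrableD measurableT icst imX.
have ig : P.-integrable setT (EFin \o (g \o X)).
  have := integrableB measurableT ifX il.
  by apply: eq_integrable => // w _ /=; rewrite -EFinM -EFinD -EFinN -EFinD.
rewrite unlock.
have -> : (\int[P]_w ((f \o X) w)%:E =
    \int[P]_w (((EFin \o cst (f 0%R)) w + m%:E * (X w)%:E) + (g (X w))%:E))%E.
  apply: eq_integral => w _ /=; rewrite -EFinM -!EFinD /g; congr (_ %:E); ring.
rewrite integralD// integralD// integralZl// EX mule0 adde0/=.
have -> : (\int[P]_w (f 0%R)%:E = (f 0%R)%:E)%E.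
  by rewrite integral_cst//= probability_setT mule1.
congr (_ + _)%E.
rewrite -ge0_integralD//.
- apply: eq_integral => w _; rewrite -EFinD; congr (_ %:E).
  have g00 : g 0 = 0 by rewrite /g mulr0 addr0 subrr.
  have [x0|x0] := leP 0 (X w).
    by rewrite max_r ?oppr_le0// oppr0 g00 addr0.
  by rewrite max_l ?oppr_ge0 ?(ltW x0)// opprK g00 add0r.
- by move=> w _; rewrite lee_fin.
- by apply/measurable_EFinP; apply: (measurableT_comp mgp).
- by move=> w _; rewrite lee_fin.
- apply/measurable_EFinP; apply: (measurableT_comp mgm) => //.
  exact: measurableT_comp.
Qed.

Lemma cx_le_stop_loss (R : realType)
    d (T : measurableType d) (P : probability T R)
    d' (T' : measurableType d') (P' : probability T' R)
    (X : T -> R) (Y : T' -> R) :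
  P.-integrable setT (EFin \o X) -> (\int[P]_w (X w)%:E = 0)%E ->
  P'.-integrable setT (EFin \o Y) -> (\int[P']_w (Y w)%:E = 0)%E ->
  (forall u, 0 <= u -> (stop_loss P X u <= stop_loss P' Y u)%E) ->
  (forall u, 0 <= u -> (stop_loss P (\- X)%R u <= stop_loss P' (\- Y)%R u)%E) ->
  cx_le P P' X Y.
Proof.
move=> iX EX iY EY XY NXY f cf ifX ifY.
have [m fm] := convex_subgradient0 cf.
pose g x := f x - (f 0 + m * x).
have g0 : g 0 = 0 by rewrite /g mulr0 addr0 subrr.
have gge0 x : 0 <= g x by rewrite subr_ge0.
have cg : convex_function (setT : set R^o) g.
  apply: convex_functionI => t x y t0 t1.
  by have := convex_function_le x y cf t0 t1; rewrite /g; lra.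
have cgN : convex_function (setT : set R^o) (g \o -%R).
  apply: convex_functionI => t x y t0 t1 /=.
  by have := convex_function_le (- x) (- y) cg t0 t1; rewrite !mulrN -opprD.
have gN0 : (g \o -%R) 0 = 0 by rewrite /= oppr0.
have mgp : measurable_fun [set: R] (fun x : R => g (Num.max x 0)).
  by apply: nondecreasing_measurable => //; apply: positive_part_homo.
have mgm : measurable_fun [set: R] (fun x : R => g (- Num.max x 0)).
  apply: nondecreasing_measurable => //.
  by apply: (@positive_part_homo _ (g \o -%R)) => // x; exact: gge0.
(* Measurability of [f \o Z] is read off from its integrability. *)
have mg dd (U : measurableType dd) (Q : probability U R) (Z : U -> R) :
    Q.-integrable setT (EFin \o Z) -> Q.-integrable setT (EFin \o (f \o Z)) ->
    measurable_fun setT Z /\ measurable_fun setT (g \o Z).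
  move=> /measurable_int/measurable_EFinP mZ /measurable_int/measurable_EFinP mf.
  split=> //; apply: measurable_funB => //; apply: measurable_funD => //.
  exact: measurable_funM.
have [mX mgX] := mg _ _ _ _ iX ifX.
have [mY mgY] := mg _ _ _ _ iY ifY.
rewrite (integral_convex_split mgX)// (integral_convex_split mgY)//.
apply: leeD2l; apply: leeD.
  apply: (le_integral_monotone_convex (g := fun x => g (Num.max x 0))) => //.
  - exact: positive_part_convex.
  - exact: positive_part_homo.
  - exact: positive_part_le0.
(* The left half of [g] becomes nondecreasing after reflection, so it is tested on the negated
   variables. *)
apply: (@le_integral_monotone_convex _ _ _ _ _ _ _ (\- X) (\- Y)
  (fun x => g (- Num.max x 0))) => //.
- by apply: (@positive_part_convex _ (g \o -%R)) => // x; exact: gge0.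
- by apply: (@positive_part_homo _ (g \o -%R)) => // x; exact: gge0.
- by apply: (@positive_part_le0 _ (g \o -%R)).
- exact: measurableT_comp.
- exact: measurableT_comp.
Qed.

(** * The constants *)

Lemma integral_expRN (R : realType) (b : R) :
  (\int[lebesgue_measure]_(x in `[b, +oo[) (expR (- x))%:E = (expR (- b))%:E)%E.
Proof.
have dF (x : R) : is_derive x 1 (fun x => - expR (- x)) (expR (- x)).
  by apply: is_derive_eq; rewrite ?mulrN1 ?opprK ?mulNr ?mulN1r ?opprK.
have cE : continuous (fun x : R => expR (- x)).
  by move=> x; apply: continuous_comp; [exact: opp_continuous|exact: continuous_expR].
rewrite (@ge0_continuous_FTC2y _ _ (fun x => - expR (- x)) _ 0)//.
- by rewrite sub0e EFinN oppeK.
- exact: continuous_subspaceT.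
- by rewrite -oppr0; apply: cvgN; exact: cvgr_expR.
- by apply: cvgN; apply/cvg_at_right_filter; exact: cE.
- by move=> x _; rewrite derive1E derive_val.
Qed.

Section exponential_tail_constants.
Context {R : realType}.
Local Notation mu := (@lebesgue_measure R).
Local Notation l := (ln (2 : R)).

Lemma expR_ln2 : expR l = 2. Proof. by rewrite lnK ?posrE. Qed.

Lemma expRN_ln2 : expR (- l) = 2^-1. Proof. by rewrite expRN expR_ln2. Qed.

Lemma ln2_gt0 : 0 < l. Proof. by rewrite ln_gt0// ltr1n. Qed.

Lemma s_E_ge0 (t : R) : 0 <= s_E t.
Proof. by rewrite /s_E le_min ler01 mulr_ge0 ?expR_ge0. Qed.

Lemma s_E_le (t : R) : s_E t <= 2 * expR (- t).
Proof. by rewrite /s_E ge_min lexx orbT. Qed.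

Lemma s_E_ge (t : R) : l <= t -> s_E t = 2 * expR (- t).
Proof.
move=> lt; rewrite /s_E min_r// -ler_pdivlMl// mulr1 -expRN_ln2.
by rewrite ler_expR lerN2.
Qed.

Lemma s_E_lt (t : R) : t <= l -> s_E t = 1.
Proof.
move=> tl; rewrite /s_E min_l// -ler_pdivrMl// mulr1 -expRN_ln2.
by rewrite ler_expR lerN2.
Qed.

Lemma measurable_s_E : measurable_fun setT (@s_E R).
Proof.
apply: measurable_minr => //; apply: measurable_funM => //.
by apply: measurableT_comp => //; exact: measurable_expR.
Qed.

Lemma integral_s_E_ge (x : R) : l <= x ->
  (\int[mu]_(t in `[x, +oo[) (s_E t)%:E = (2 * expR (- x))%:E)%E.
Proof.
move=> lx.
rewrite EFinM -integral_expRN -ge0_integralZl_EFin//.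
- apply: eq_integral => t; rewrite inE/= in_itv/= andbT => xt.
  by rewrite s_E_ge ?EFinM// (le_trans lx).
- by apply/measurable_EFinP; apply: measurableT_comp.
Qed.

(** The integral is cut at [ln 2], where [s_E] leaves the value 1: the flat piece contributes its
    length and the exponential piece contributes 1. *)
Lemma integral_s_E_le (x : R) : x <= l ->
  (\int[mu]_(t in `[x, +oo[) (s_E t)%:E = (l - x + 1)%:E)%E.
Proof.
rewrite le_eqVlt => /predU1P[->|xl].
  by rewrite integral_s_E_ge// expRN_ln2 subrr add0r divff.
have -> : `[x, +oo[%classic = `[x, l[ `|` `[l, +oo[ :> set R.
  apply/seteqP; split=> t /=; rewrite !in_itv/= !andbT.
    by move=> ->/=; case: ltP => ?; [left|right].
  by case=> [/andP[]//|]; apply: le_trans; exact: ltW.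
rewrite ge0_integral_setU//=.
- rewrite integral_s_E_ge// expRN_ln2 divff// EFinD; congr (_ + _)%E.
  rewrite (_ : (\int[mu]_(t in `[x, l[) (s_E t)%:E =
                \int[mu]_(t in `[x, l[) (cst 1 t))%E).
    by rewrite integral_cst//= lebesgue_measure_itv/= lte_fin xl mul1e EFinB.
  apply: eq_integral => t; rewrite inE/= in_itv/= => /andP[_ tl].
  by rewrite s_E_lt// ltW.
- apply/measurable_EFinP; apply: measurable_funTS; exact: measurable_s_E.
- by move=> t _; rewrite lee_fin s_E_ge0.
- apply/disj_setPS => t /= []; rewrite !in_itv/= andbT => /andP[_ tl].
  by rewrite leNgt tl.
Qed.

Lemma integral0y_s_E : (\int[mu]_(t in `[0%R, +oo[) (s_E t)%:E = (l + 1)%:E)%E.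
Proof. by rewrite integral_s_E_le ?subr0// ltW// ln2_gt0. Qed.

Lemma B_E_val : B_E R = (1 + l) / 2.
Proof. by rewrite /B_E /A_E /Rintegral integral0y_s_E/= addrC. Qed.

Lemma H_E_ge (x : R) : l <= x -> H_E x = 2 * (1 + x) * expR (- x).
Proof.
move=> lx; rewrite /H_E /Rintegral integral_s_E_ge// s_E_ge//=; ring.
Qed.

Lemma H_E_le (x : R) : x <= l -> H_E x = 1 + l.
Proof.
move=> xl; rewrite /H_E /Rintegral integral_s_E_le// s_E_lt//=; ring.
Qed.

(** This gives content to the choice operator in [a_E]. The intermediate value theorem is applied on
    [[ln 2, 8]] to the exponential form of [H_E]. *)
Lemma exists_a_E : exists a : R, 0 < a /\ H_E a = B_E R.
Proof.
have l0 := ln2_gt0.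
have e1 : 2 <= expR 1 :> R by have := expR_ge1Dx (1 : R); lra.
have l1 : l <= 1 by rewrite -ler_expR expR_ln2.
pose F x : R := 2 * (1 + x) * expR (- x).
have cF : continuous F.
  move=> x; apply: cvgM; last first.
    by apply: continuous_comp; [exact: opp_continuous|exact: continuous_expR].
  by apply: cvgMr; apply: cvgD; [exact: cvg_cst|exact: cvg_id].
(* The endpoint 8 is merely convenient: [2 <= expR 1] gives [F 8 <= 18 / 2 ^+ 8], which is below one
   half. *)
have F8 : F 8 <= (1 + l) / 2.
  have -> : F 8 = 18 / (expR 1) ^+ 8.
    by rewrite /F expRN -expRM_natl mulr1; congr (_ / _); ring.
  have : 2 ^+ 8 <= (expR 1) ^+ 8 :> R by rewrite lerXn2r ?nnegrE ?expR_ge0.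
  move=> e8; rewrite ler_pdivrMr ?exprn_gt0 ?expR_gt0//; nra.
have Fl : (1 + l) / 2 <= F l by rewrite /F expRN_ln2; lra.
have [a] := @IVT R F l 8 ((1 + l) / 2) ltac:(lra) (continuous_subspaceT cF)
  ltac:(by rewrite ge_min le_max F8 Fl !orbT).
rewrite in_itv/= => /andP[la _] Fa; exists a; split; first lra.
by rewrite H_E_ge// B_E_val.
Qed.

Local Notation a := (a_E R).
Local Notation p := (p_E R).

(** For [a] in [[ln 2, 2 ln 2]], the bound [1 + y <= expR y] at [y = 2 ln 2 - a] gives [H_E a >= (1
    + a) (1 + 2 ln 2 - a) / 2 >= (1 + 2 ln 2) / 2], which exceeds [B_E]; below [ln 2], [H_E] is
    twice [B_E]. *)
Lemma a_E_gt_2ln2 : 2 * l < a.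
Proof.
have [] : 0 < a /\ H_E a = B_E R := getPex exists_a_E.
rewrite B_E_val => a0 Ha; rewrite ltNge; apply/negP => al.
have l0 := ln2_gt0.
have [la|/ltW la] := leP l a; last by move: Ha; rewrite H_E_le//; lra.
move: Ha; rewrite H_E_ge// => Ha.
have e4 : expR (- (2 * l)) = 4^-1.
  by rewrite mulrC -mulNr expRM_natr expRN_ln2; lra.
have : expR (- a) = expR (- (2 * l)) * expR (2 * l - a).
  by rewrite -expRD; congr expR; ring.
rewrite e4 => Ea.
have := expR_ge1Dx (2 * l - a); rewrite Ea in Ha; nra.
Qed.

Lemma p_E_val : p = 2 * expR (- a).
Proof.
rewrite /p_E s_E_ge//; have := a_E_gt_2ln2; have := ln2_gt0; lra.
Qed.

(** Beyond [a] the integral of [s_E] is again [p], so the equation defining [a] takes this form. *)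
Lemma B_E_p_E : B_E R = p * (1 + a).
Proof.
have [] : 0 < a /\ H_E a = B_E R := getPex exists_a_E.
have := a_E_gt_2ln2; have := ln2_gt0 => l0 la a0 <-.
by rewrite H_E_ge ?p_E_val; [ring|lra].
Qed.

Lemma w_E_val : w_E R = a - 2 * l.
Proof.
rewrite /w_E p_E_val.
have -> : 1 / (2 * (2 * expR (- a))) = expR (a - 2 * l).
  rewrite expRD expRN.
  have -> : expR (- (2 * l)) = 4^-1.
    by rewrite mulrC -mulNr expRM_natr expRN_ln2; lra.
  by field; rewrite gt_eqF ?expR_gt0.
by rewrite expRK.
Qed.

(** Cancelling [p] exposes the tangency relation [c (1 + w) = 1 + a] and, as [w <= a], the bound
    [1 <= c]. *)
Lemma c_E_val : c_E R = (1 + a) / (1 + w_E R).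
Proof.
rewrite /c_E B_E_p_E w_E_val.
have p0 : 0 < p by rewrite p_E_val mulr_gt0 ?expR_gt0.
have := a_E_gt_2ln2; have := ln2_gt0 => l0 la.
by field; rewrite !gt_eqF//; lra.
Qed.

End exponential_tail_constants.

(** * Stop-loss functions *)

Section stop_loss_theory.
Context {R : realType} d (T : measurableType d) (P : probability T R).
Local Notation mu := (@lebesgue_measure R).
Variable X : T -> R.
Hypothesis mX : measurable_fun setT X.

Lemma measurable_gt (u : R) : measurable [set w | u < X w].
Proof.
rewrite -[X in measurable X]setTI.
have -> : [set w | u < X w] = X @^-1` `]u, +oo[.
  by apply/seteqP; split=> w /=; rewrite in_itv/= andbT.
exact: mX.
Qed.

(** Layer-cake formula for the positive part of [X - u]. Measurability of the tail is recorded with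
    it, for comparing integrals of tails. *)
Lemma stop_loss_ccdf (u : R) :
  (stop_loss P X u = \int[mu]_(r in `[0%R, +oo[) P [set w | (u + r < X w)%R])%E /\
  measurable_fun (`[0, +oo[ : set R) (fun r : R => P [set w | (u + r < X w)%R]).
Proof.
have mZ : measurable_fun setT (fun w => Num.max (X w - u) 0).
  exact/measurable_EFinP/measurable_hinge.
pose Z : {RV P >-> R} := mfun_Sub (mem_set mZ).
(* Truncation at 0 leaves the level sets above a nonnegative [r] unchanged. *)
have ZE r : 0 <= r -> ccdf Z r = P [set w | (u + r < X w)%R].
  move=> r0; rewrite /ccdf /distribution /pushforward; congr (P _).
  apply/seteqP; split=> w /=; rewrite in_itv/= andbT lt_max.
    by case/orP => [|]; [rewrite ltrBrDl|rewrite ltNge r0].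
  by rewrite ltrBrDl => ->.
split.
  have := @ge0_expectation_ccdf _ _ _ P Z; rewrite unlock => H.
  rewrite /stop_loss [LHS]H; last by move=> w /=; rewrite le_max lexx orbT.
  by apply: eq_integral => r; rewrite inE/= in_itv/= andbT => /ZE.
apply: (eq_measurable_fun (ccdf Z)).
  by move=> r; rewrite inE/= in_itv/= andbT => /ZE.
by apply: measurable_funTS; exact: ccdf_measurable.
Qed.

Lemma stop_loss_eq_tail (u : R) (G : R -> R) :
  (forall r, 0 <= r -> P [set w | u + r < X w] = (G r)%:E) ->
  (stop_loss P X u = \int[mu]_(r in `[0%R, +oo[) (G r)%:E)%E.
Proof.
move=> PG; rewrite (stop_loss_ccdf u).1; apply: eq_integral => r.
by rewrite inE/= in_itv/= andbT => /PG.
Qed.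

Lemma stop_loss_le_tail (u : R) (G : R -> R) : measurable_fun setT G ->
  (forall r, 0 <= r -> (P [set w | (u + r < X w)%R] <= (G r)%:E)%E) ->
  (stop_loss P X u <= \int[mu]_(r in `[0%R, +oo[) (G r)%:E)%E.
Proof.
move=> mG PG; have [-> mP] := stop_loss_ccdf u.
apply: ge0_le_integral => //.
  by apply/measurable_EFinP; exact: measurable_funTS.
by move=> r; rewrite /= in_itv/= andbT => /PG.
Qed.

Let integral_tail (u c : R) : 0 <= c ->
  (\int[P]_w (c * \1_[set w | u < X w] w)%:E = c%:E * P [set w | (u < X w)%R])%E.
Proof.
move=> c0; under eq_integral do rewrite EFinM.
rewrite ge0_integralZl_EFin//.
- by rewrite integral_indic ?setIT//; exact: measurable_gt.
- by apply/measurable_EFinP; apply: measurable_indic; exact: measurable_gt.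
Qed.

Let measurable_tail (u c : R) :
  measurable_fun setT (fun w => (c * \1_[set w | u < X w] w)%:E).
Proof.
apply/measurable_EFinP; apply: measurable_funM => //.
by apply: measurable_indic; exact: measurable_gt.
Qed.

(** Lowering the hinge from [v] to [u] adds at most [v - u], and only where [u < X]. *)
Lemma stop_loss_le_secant (u v : R) : u <= v ->
  (stop_loss P X u <= stop_loss P X v + (v - u)%:E * P [set w | (u < X w)%R])%E.
Proof.
move=> uv; rewrite -integral_tail ?subr_ge0// -ge0_integralD//.
- apply: ge0_le_integral => //.
  + by move=> w _; exact: hinge_ge0.
  + exact: measurable_hinge.
  + apply: emeasurable_funD; [exact: measurable_hinge|exact: measurable_tail].
  + move=> w _; rewrite -EFinD lee_fin indicE.
    have [uw|uw] := ltP u (X w).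
      rewrite mem_set// mulr1 [leLHS]max_l ?subr_ge0 ?(ltW uw)//.
      have : X w - v <= Num.max (X w - v) 0.
        by rewrite le_max lexx.
      have : 0 <= Num.max (X w - v) 0 by rewrite le_max lexx orbT.
      by lra.
    rewrite memNset/= ?mulr0 ?addr0; last by apply/negP; rewrite -leNgt.
    by rewrite max_r ?subr_le0// le_max lexx orbT.
- by move=> w _; exact: hinge_ge0.
- exact: measurable_hinge.
- by move=> w _; rewrite lee_fin mulr_ge0// subr_ge0.
Qed.

(** Lowering the hinge from [v] to [u] adds the full [v - u] wherever [v < X]. *)
Lemma secant_le_stop_loss (u v : R) : u <= v ->
  (stop_loss P X v + (v - u)%:E * P [set w | (v < X w)%R] <= stop_loss P X u)%E.
Proof.
move=> uv; rewrite -integral_tail ?subr_ge0// -ge0_integralD//.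
- apply: ge0_le_integral => //.
  + by move=> w _; rewrite adde_ge0 ?hinge_ge0// lee_fin mulr_ge0// subr_ge0.
  + apply: emeasurable_funD; [exact: measurable_hinge|exact: measurable_tail].
  + exact: measurable_hinge.
  + move=> w _; rewrite -EFinD lee_fin indicE.
    have [vw|vw] := ltP v (X w).
      rewrite mem_set// mulr1 !max_l ?subr_ge0 ?(ltW vw) ?(le_trans uv) ?(ltW vw)//.
      by lra.
    rewrite memNset/= ?mulr0 ?addr0; last by apply/negP; rewrite -leNgt.
    by rewrite max_r ?subr_le0// le_max lexx orbT.
- by move=> w _; exact: hinge_ge0.
- exact: measurable_hinge.
- by move=> w _; rewrite lee_fin mulr_ge0// subr_ge0.
Qed.

Lemma integral_normr_stop_loss :
  (\int[P]_w (`|X w|)%:E = stop_loss P X 0 + stop_loss P (\- X)%R 0)%E.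
Proof.
rewrite -ge0_integralD//.
- apply: eq_integral => w _; rewrite -EFinD !subr0 /=.
  have [x0|x0] := leP 0 (X w).
    by rewrite ger0_norm// max_r ?oppr_le0// addr0.
  by rewrite ltr0_norm// max_l ?oppr_ge0 ?(ltW x0)// add0r.
- by move=> w _; exact: hinge_ge0.
- exact: measurable_hinge.
- by move=> w _; exact: hinge_ge0.
- by apply: measurable_hinge; exact: measurableT_comp.
Qed.

Lemma stop_loss_norm : stop_loss P (fun w => `|X w|) 0 = (\int[P]_w (`|X w|)%:E)%E.
Proof.
by apply: eq_integral => w _; rewrite subr0 max_l.
Qed.

Lemma integral_stop_loss : P.-integrable setT (EFin \o X) ->
  (\int[P]_w (X w)%:E = stop_loss P X 0 - stop_loss P (\- X)%R 0)%E.
Proof.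
move=> iX.
have iH (Z : T -> R) : measurable_fun setT Z -> (forall w, `|Z w| = `|X w|) ->
    P.-integrable setT (fun w => (Num.max (Z w - 0) 0)%:E).
  move=> mZ ZX; apply: (le_integrable measurableT _ _ iX).
    exact: measurable_hinge.
  move=> w _ /=; rewrite lee_fin -ZX subr0.
  by have [|z0] := leP 0 (Z w) => //; rewrite normr0.
rewrite -integralB//.
- apply: eq_integral => w _; rewrite -EFinB !subr0 /=.
  have [x0|x0] := leP 0 (X w).
    by rewrite max_r ?oppr_le0// subr0.
  by rewrite max_l ?oppr_ge0 ?(ltW x0)// sub0r opprK.
- exact: iH.
- by apply: iH => [|w]; [exact: measurableT_comp|rewrite normrN].
Qed.

End stop_loss_theory.

Lemma integral0y_expRN (R : realType) (c : R) : 0 <= c ->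
  (\int[lebesgue_measure]_(r in `[0%R, +oo[) (c * expR (- r))%:E = c%:E)%E.
Proof.
move=> c0; under eq_integral do rewrite EFinM.
rewrite ge0_integralZl_EFin//.
  by rewrite integral_expRN oppr0 expR0 mule1.
by apply/measurable_EFinP; apply: measurableT_comp.
Qed.

Lemma measurable_cexpRN (R : realType) (c : R) :
  measurable_fun [set: R] (fun r : R => c * expR (- r)).
Proof. by apply: measurable_funM => //; apply: measurableT_comp. Qed.

(** * Laplace stop-loss and the tail bound *)

Section laplace.
Context {R : realType} d (T : measurableType d) (P : probability T R).
Variable L : {RV P >-> R}.
Hypothesis hL : standard_laplace L.
Local Notation mu := (@lebesgue_measure R).

Let mL : measurable_fun setT (L : T -> R).
Proof. exact: measurable_funPT. Qed.

Let mNL : measurable_fun setT (\- (L : T -> R)).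
Proof. exact: measurableT_comp. Qed.

Let continuous_laplace_pdf : continuous (@laplace_pdf R).
Proof.
move=> x; apply: cvgMr.
apply: (continuous_comp (f := fun x : R => - `|x|) (g := @expR R)).
  by apply: cvgN; exact: norm_continuous.
exact: continuous_expR.
Qed.

Let measurable_laplace_pdf (D : set R) : measurable_fun D (EFin \o @laplace_pdf R).
Proof.
apply/measurable_EFinP; apply: measurable_funTS; exact: continuous_measurable_fun.
Qed.

Let integral_laplace_pdf (t : R) : 0 <= t ->
  (\int[mu]_(x in `[t, +oo[) (laplace_pdf x)%:E = (2^-1 * expR (- t))%:E)%E.
Proof.
move=> t0; rewrite EFinM -integral_expRN -ge0_integralZl_EFin//.
- apply: eq_integral => x; rewrite inE/= in_itv/= andbT => tx.
  by rewrite /laplace_pdf ger0_norm ?EFinM// (le_trans t0).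
- by apply/measurable_EFinP; apply: measurableT_comp.
Qed.

Lemma laplace_tail (t : R) : 0 <= t ->
  P [set w | t < L w] = (2^-1 * expR (- t))%:E.
Proof.
move=> t0; rewrite -integral_laplace_pdf// -integral_itv_obnd_cbnd; last first.
  exact: measurable_laplace_pdf.
rewrite -hL//; congr (P _); apply/seteqP.
by split=> w /=; rewrite in_itv/= andbT.
Qed.

Lemma laplace_tailN (t : R) : 0 <= t ->
  P [set w | t < - L w] = (2^-1 * expR (- t))%:E.
Proof.
move=> t0; rewrite -integral_laplace_pdf//.
transitivity (\int[mu]_(x in `]-oo, (- t)%R[) (laplace_pdf x)%:E)%E.
  rewrite -hL//; congr (P _); apply/seteqP.
  by split=> w /=; rewrite in_itv/= ltrNr.
rewrite integral_itv_bndo_bndc; last exact: measurable_laplace_pdf.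
(* Reflection to the right half-line, where the even density is unchanged. *)
rewrite ge0_integration_by_substitutionNy.
- by apply: eq_integral => x _; rewrite /= /laplace_pdf normrN.
- exact: continuous_subspaceT.
- by move=> x _; rewrite mulr_ge0 ?expR_ge0.
Qed.

Lemma laplace_tail_norm (t : R) : 0 <= t ->
  P [set w | t < `|L w|] = (expR (- t))%:E.
Proof.
move=> t0.
have -> : [set w | t < `|L w|] = [set w | t < L w] `|` [set w | t < - L w].
  by apply/seteqP; split=> w /=; rewrite ltr_normr => /orP.
rewrite measureU.
- transitivity ((2^-1 * expR (- t))%:E + (2^-1 * expR (- t))%:E)%E.
    by congr (_ + _)%E; [exact: laplace_tail|exact: laplace_tailN].
  by rewrite -EFinD; congr (_ %:E); lra.
- exact: measurable_gt.
- exact: (measurable_gt mNL).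
- by apply/seteqP; split=> w //= -[]; lra.
Qed.

(** The tail at [v + r] factors into the tail at [v] times [expR (- r)], whose integral is 1. *)
Lemma laplace_stop_loss (v : R) : 0 <= v ->
  stop_loss P L v = (2^-1 * expR (- v))%:E.
Proof.
move=> v0; rewrite (@stop_loss_eq_tail _ _ _ P _ mL v
  (fun r => (2^-1 * expR (- v)) * expR (- r))).
- by rewrite integral0y_expRN// mulr_ge0 ?expR_ge0.
- by move=> r r0; rewrite laplace_tail ?addr_ge0// opprD expRD mulrA.
Qed.

Lemma laplace_stop_lossN (v : R) : 0 <= v ->
  stop_loss P (\- L) v = (2^-1 * expR (- v))%:E.
Proof.
move=> v0; rewrite (@stop_loss_eq_tail _ _ _ P _ mNL v
  (fun r => (2^-1 * expR (- v)) * expR (- r))).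
- by rewrite integral0y_expRN// mulr_ge0 ?expR_ge0.
- by move=> r r0; rewrite laplace_tailN ?addr_ge0// opprD expRD mulrA.
Qed.

Lemma laplace_integrable : P.-integrable setT (EFin \o L).
Proof.
apply/integrableP; split; first exact/measurable_EFinP.
rewrite (eq_integral (fun w => (`|L w|)%:E)); last by [].
rewrite integral_normr_stop_loss// laplace_stop_loss// laplace_stop_lossN//.
by rewrite -EFinD ltry.
Qed.

Lemma laplace_mean : (\int[P]_w (L w)%:E = 0)%E.
Proof.
rewrite integral_stop_loss//; last exact: laplace_integrable.
by rewrite laplace_stop_loss// laplace_stop_lossN// -EFinB subrr.
Qed.

End laplace.

Section scaling.
Context {R : realType} d (T : measurableType d) (P : probability T R).

Lemma stop_lossZ (X : T -> R) (c u : R) : 0 < c -> measurable_fun setT X ->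
  stop_loss P (c \*o X) u = (c%:E * stop_loss P X (u / c))%E.
Proof.
move=> c0 mX; rewrite /stop_loss -ge0_integralZl_EFin ?(ltW c0)//.
- apply: eq_integral => w _; rewrite -EFinM; congr (_ %:E).
  by rewrite maxr_pMr ?(ltW c0)// mulr0 mulrBr mulrCA divff ?mulr1// gt_eqF.
- by move=> w _; exact: hinge_ge0.
- exact: measurable_hinge.
Qed.

End scaling.

(** * Stop-loss bounds under the tail condition *)

Section tail_bound.
Context {R : realType} d (T : measurableType d) (P : probability T R).
Variable X : T -> R.
Hypothesis mX : measurable_fun setT X.
Hypothesis iX : P.-integrable setT (EFin \o X).
Hypothesis EX : (\int[P]_w (X w)%:E = 0)%E.
Hypothesis tailX : forall t, 0 <= t -> (P [set w | (t < `|X w|)%R] <= (s_E t)%:E)%E.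
Local Notation a := (a_E R).
Local Notation p := (p_E R).

Let tail_gt (t : R) : 0 <= t -> (P [set w | (t < X w)%R] <= (s_E t)%:E)%E.
Proof.
move=> t0; apply: le_trans (tailX t0).
apply: le_measure; rewrite ?inE; [exact: measurable_gt| |].
  by apply: measurable_gt; exact: measurableT_comp.
by move=> w /= /lt_le_trans; apply; exact: ler_norm.
Qed.

Lemma stop_loss_le_expR (u : R) : 0 <= u -> (stop_loss P X u <= (2 * expR (- u))%:E)%E.
Proof.
move=> u0; rewrite -integral0y_expRN ?mulr_ge0 ?expR_ge0//.
apply: stop_loss_le_tail => //; first exact: measurable_cexpRN.
move=> r r0; apply: (le_trans (tail_gt (addr_ge0 u0 r0))).
by rewrite lee_fin -mulrA -expRD -opprD s_E_le.
Qed.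

(** Mean zero shares the integral of the modulus equally between the stop-losses of [X] and [- X] at
    0, and that integral is at most [1 + ln 2]. *)
Lemma stop_loss0_le : (stop_loss P X 0 <= (B_E R)%:E)%E.
Proof.
have : (stop_loss P X 0 + stop_loss P (\- X)%R 0 <= (1 + ln 2)%:E)%E.
  rewrite -integral_normr_stop_loss// -stop_loss_norm addrC -integral0y_s_E.
  apply: stop_loss_le_tail; [exact: measurableT_comp|exact: measurable_s_E|].
  by move=> r r0; rewrite add0r; exact: tailX.
move: EX; rewrite integral_stop_loss//.
have := stop_loss_ge0 P X 0; have := stop_loss_ge0 P (\- X) 0.
case: (stop_loss P X 0) => [x| |]//; case: (stop_loss P (\- X) 0) => [y| |]//.
rewrite -EFinB -EFinD !lee_fin B_E_val => x0 y0 [xy] H.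
by rewrite ler_pdivlMr//; lra.
Qed.

(* [G := P(X > u)] either is at most [p], and the secant from [u] to [a]
   applies, or exceeds [p], and then [E X+ <= B] leaves at most [B - u p]. *)
Lemma stop_loss_le_affine (u : R) : 0 <= u -> u <= a ->
  (stop_loss P X u <= (p * (1 + a - u))%:E)%E.
Proof.
move=> u0 ua; have p0 : 0 <= p by exact: s_E_ge0.
have := stop_loss_le_secant P mX ua; have := secant_le_stop_loss P mX u0.
rewrite -(fineK (fin_num_measure P _ (measurable_gt mX u))).
set G := fine _ => H1 H2.
have a0 : 0 <= a by exact: le_trans ua.
have [Gp|/ltW pG] := leP G p.
  apply: (le_trans H2); rewrite -EFinM.
  apply: (le_trans (leeD2r _ (stop_loss_le_expR a0))).
  rewrite -EFinD lee_fin -p_E_val.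
  have : (a - u) * G <= (a - u) * p by rewrite ler_wpM2l// subr_ge0.
  by lra.
have := le_trans H1 stop_loss0_le; rewrite subr0 -EFinM B_E_p_E.
case: (stop_loss P X u) => [x| |];
  [|by rewrite addye// leye_eq => /eqP|by move=> _; rewrite leNye].
rewrite -EFinD !lee_fin => H.
by have : u * p <= u * G by [rewrite ler_wpM2l]; lra.
Qed.

Lemma stop_loss_le_laplace (u : R) : 0 <= u ->
  (stop_loss P X u <= (c_E R / 2 * expR (- (u / c_E R)))%:E)%E.
Proof.
move=> u0; have la := @a_E_gt_2ln2 R; have l0 := @ln2_gt0 R.
have Ep := @p_E_val R; have Ew := @w_E_val R; have Ec := @c_E_val R.
set c := c_E R in Ec *; set w := w_E R in Ew Ec.
have w1 : 0 < 1 + w by lra.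
have cw : c * (1 + w) = 1 + a by rewrite Ec divfK ?gt_eqF.
have c1 : 1 <= c by rewrite Ec ler_pdivlMr//; lra.
have c0 : 0 < c by lra.
have p0 : 0 < p by rewrite Ep mulr_gt0 ?expR_gt0.
(* Since [expR (- w) = 2 p], this is [1 + y <= expR y] at [y = w - v / c], scaled by [c p]; equality
   holds at [v = c w]. *)
have tangent v : p * (1 + a - v) <= c / 2 * expR (- (v / c)).
  have -> : expR (- (v / c)) = 2 * p * expR (w - v / c).
    rewrite expRD mulrA -[LHS]mul1r; congr (_ * _).
    rewrite Ep Ew mulrA -mulrA -expRD.
    have -> : - a + (a - 2 * ln 2) = - (ln 2 + ln 2) by ring.
    by rewrite opprD expRD expRN_ln2; lra.
  have := expR_ge1Dx (w - v / c).
  rewrite -(ler_pM2l (mulr_gt0 c0 p0)) => H.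
  apply: le_trans (le_trans H _); last lra.
  have -> : c * p * (1 + (w - v / c)) = p * (c * (1 + w) - v).
    by field; rewrite gt_eqF.
  by rewrite cw.
have [ua|/ltW au] := leP u a.
  by rewrite (le_trans (stop_loss_le_affine u0 ua))// lee_fin.
rewrite (le_trans (stop_loss_le_expR u0))// lee_fin.
(* At [v = a] the tangent bound compares the two exponentials; beyond [a] they decay at rates 1 and
   [1 / c], with [1 <= c]. *)
have := tangent a; rewrite addrK mulr1 Ep => H.
have -> : 2 * expR (- u) = 2 * expR (- a) * expR (- (u - a)).
  by rewrite -[RHS]mulrA -expRD; congr (_ * expR _); ring.
have -> : c / 2 * expR (- (u / c)) = c / 2 * expR (- (a / c)) * expR (- ((u - a) / c)).
  by rewrite -[RHS]mulrA -expRD; congr (_ * expR _); field; rewrite gt_eqF.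
apply: ler_pM; rewrite ?mulr_ge0 ?expR_ge0//.
by rewrite ler_expR lerN2 ler_pdivrMr// ler_peMr// subr_ge0.
Qed.

End tail_bound.

(** * Comparison and optimality *)

Lemma convex_hinge (R : realType) (u : R) :
  convex_function (setT : set R^o) (fun x : R => Num.max (x - u) 0).
Proof.
apply: convex_functionI => t x y t0 t1.
have hx z : 0 <= Num.max (z - u) 0 /\ z - u <= Num.max (z - u) 0.
  by rewrite !le_max !lexx orbT.
have [[x0 x1] [y0 y1]] := (hx x, hx y).
by rewrite ge_max; apply/andP; split; nra.
Qed.

Lemma integrable_hinge (R : realType) d (T : measurableType d)
    (P : probability T R) (X : T -> R) (u : R) : 0 <= u ->
  P.-integrable setT (EFin \o X) ->
  P.-integrable setT (fun w => (Num.max (X w - u) 0)%:E).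
Proof.
move=> u0 iX; apply: (le_integrable measurableT _ _ iX).
  by apply: measurable_hinge; apply/measurable_EFinP; exact: measurable_int iX.
move=> w _ /=; rewrite lee_fin ger0_norm; last by rewrite le_max lexx orbT.
rewrite ge_max normr_ge0 andbT (le_trans _ (ler_norm _))//.
by rewrite gerBl.
Qed.

Section scaled_laplace.
Context {R : realType} d (T : measurableType d) (P : probability T R).
Variables (L : {RV P >-> R}) (c : R).
Hypotheses (hL : standard_laplace L) (c0 : 0 < c).

Lemma scaled_laplace_stop_loss (u : R) : 0 <= u ->
  stop_loss P (c \*o L) u = (c / 2 * expR (- (u / c)))%:E.
Proof.
move=> u0; rewrite stop_lossZ// laplace_stop_loss//.
  by rewrite -EFinM mulrA.
by rewrite divr_ge0// ltW.
Qed.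

Lemma scaled_laplace_stop_lossN (u : R) : 0 <= u ->
  stop_loss P (\- (c \*o L)) u = (c / 2 * expR (- (u / c)))%:E.
Proof.
move=> u0; have -> : \- (c \*o L) = c \*o (\- L).
  by apply/funext => w /=; rewrite mulrN.
have mNL : measurable_fun setT (\- (L : T -> R)) by exact: measurableT_comp.
rewrite stop_lossZ// laplace_stop_lossN//.
  by rewrite -EFinM mulrA.
by rewrite divr_ge0// ltW.
Qed.

Lemma scaled_laplace_integrable : P.-integrable setT (EFin \o (c \*o L)).
Proof.
have := integrableZl measurableT c (laplace_integrable hL).
by apply: eq_integrable => // w _ /=; rewrite EFinM.
Qed.

Lemma scaled_laplace_mean : (\int[P]_w ((c \*o L) w)%:E = 0)%E.
Proof.
under eq_integral do rewrite /= EFinM.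
by rewrite integralZl//; [rewrite laplace_mean// mule0|exact: laplace_integrable].
Qed.

End scaled_laplace.

Lemma c_E_gt0 (R : realType) : 0 < c_E R.
Proof.
have := @a_E_gt_2ln2 R; have := @ln2_gt0 R; rewrite c_E_val w_E_val => l0 la.
by rewrite divr_gt0//; lra.
Qed.

Lemma cx_le_laplace (R : realType)
    d (T : measurableType d) (P : probability T R) (X : {RV P >-> R})
    d' (T' : measurableType d') (P' : probability T' R) (L : {RV P' >-> R}) :
  standard_laplace L -> centered_with_E_tail X -> cx_le P P' X (c_E R \*o L).
Proof.
move=> hL [iX EX tX]; have c0 := c_E_gt0 R.
rewrite unlock in EX.
have mX : measurable_fun setT (X : T -> R) by exact: measurable_funPT.
have mNX : measurable_fun setT (\- (X : T -> R)) by exact: measurableT_comp.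
have iNX : P.-integrable setT (EFin \o (\- (X : T -> R))).
  by have := integrableN iX; apply: eq_integrable.
apply: cx_le_stop_loss => //.
- exact: scaled_laplace_integrable.
- exact: scaled_laplace_mean.
- by move=> u u0; rewrite scaled_laplace_stop_loss//; exact: stop_loss_le_laplace.
(* Both the mean and the tail condition are invariant under negation, so the same bound serves
   [- X]. *)
- move=> u u0; rewrite scaled_laplace_stop_lossN//.
  apply: stop_loss_le_laplace => //.
    under eq_integral do rewrite /= -mulN1r EFinM.
    by rewrite integralZl// EX mule0.
  by move=> t t0; under eq_set do rewrite normrN; exact: tX.
Qed.

(* [ln 2 + |L|] has tail exactly [s_E]; the values above [a_E] keep the sign +
   and the others get the sign -. *)
Definition extremal_E (R : realType) (x : R) : R :=
  if a_E R < ln 2 + `|x| then ln 2 + `|x| else - (ln 2 + `|x|).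

(** * The extremal variable *)

Section extremal.
Context {R : realType} d (T : measurableType d) (P : probability T R).
Variable L : {RV P >-> R}.
Hypothesis hL : standard_laplace L.
Local Notation a := (a_E R).
Local Notation p := (p_E R).
Local Notation l := (ln (2 : R)).
Let X : T -> R := @extremal_E R \o L.
Let l0 : 0 < l := ln2_gt0.
Let la : 2 * l < a := a_E_gt_2ln2.

Lemma measurable_extremal_E : measurable_fun setT (@extremal_E R).
Proof.
have mY : measurable_fun setT (fun x : R => l + `|x|).
  by apply: measurable_funD => //; exact: measurable_normr.
apply: measurable_fun_ifT => //; last exact: measurableT_comp.
exact: measurable_fun_ltr.
Qed.

Let mX : measurable_fun setT X.
Proof. by apply: measurableT_comp => //; exact: measurable_extremal_E. Qed.

Let normX w : `|X w| = l + `|L w|.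
Proof.
have y0 : 0 <= l + `|L w| by rewrite addr_ge0// ltW.
by rewrite /X /= /extremal_E; case: ifP; rewrite ?normrN (ger0_norm y0).
Qed.

(** Positive values of [X] are exactly the moduli above [a]; hence the upper tail is constant on
    [[0, a]]. *)
Let X_gt t w : 0 <= t -> (t < X w) = (Num.max a t < l + `|L w|).
Proof.
move=> t0; have y0 : 0 <= `|L w| by [].
rewrite gt_max /X /= /extremal_E; case: (ltP a) => //= ya.
by apply/negbTE; rewrite -leNgt; have := l0; lra.
Qed.

Let tail_shift t : l <= t -> P [set w | t < l + `|L w|] = (2 * expR (- t))%:E.
Proof.
move=> lt; under eq_set do rewrite -ltrBlDl.
rewrite laplace_tail_norm ?subr_ge0// opprB expRD.
by rewrite lnK ?posrE.
Qed.

Let tail_normX t : 0 <= t -> P [set w | t < `|X w|] = (s_E t)%:E.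
Proof.
move=> t0; under eq_set do rewrite normX.
have [lt|tl] := leP l t; first by rewrite tail_shift// s_E_ge.
rewrite s_E_lt ?(ltW tl)// (_ : [set w | _] = setT) ?probability_setT//.
by apply/seteqP; split=> // w _ /=; rewrite ltr_wpDr.
Qed.

Let tailX t : 0 <= t -> P [set w | t < X w] = (2 * expR (- Num.max a t))%:E.
Proof.
move=> t0; under eq_set do rewrite X_gt//.
rewrite tail_shift// le_max; apply/orP; left.
by have := l0; have := la; lra.
Qed.

Lemma extremal_stop_loss (u : R) : 0 <= u -> u <= a ->
  stop_loss P X u = (p * (1 + a - u))%:E.
Proof.
move=> u0 ua; have a0 : 0 <= a := le_trans u0 ua.
have stop_a : stop_loss P X a = p%:E.
  rewrite (@stop_loss_eq_tail _ _ _ P _ mX a (fun r => p * expR (- r))).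
    by rewrite integral0y_expRN// s_E_ge0.
  move=> r r0; rewrite tailX ?addr_ge0// max_r ?lerDl// p_E_val.
  by rewrite opprD expRD mulrA.
have tail_u v : 0 <= v -> v <= a -> P [set w | v < X w] = p%:E.
  by move=> v0 va; rewrite tailX// max_l// p_E_val.
have -> : (p * (1 + a - u))%:E = (stop_loss P X a + (a - u)%:E * p%:E)%E.
  by rewrite stop_a -EFinM -EFinD; congr (_ %:E); ring.
(* The upper and lower secant bounds coincide, since the tail equals [p] both at [u] and at [a]. *)
apply/le_anti/andP; split.
  by have := stop_loss_le_secant P mX ua; rewrite tail_u.
by have := secant_le_stop_loss P mX ua; rewrite tail_u.
Qed.

Let integral_normX : (\int[P]_w (`|X w|)%:E = (l + 1)%:E)%E.
Proof.
rewrite -stop_loss_norm -integral0y_s_E.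
apply: stop_loss_eq_tail; first exact: measurableT_comp.
by move=> r r0; rewrite add0r; exact: tail_normX.
Qed.

Let iX : P.-integrable setT (EFin \o X).
Proof.
apply/integrableP; split; first exact/measurable_EFinP.
rewrite (eq_integral (fun w => (`|X w|)%:E)); last by [].
by rewrite integral_normX ltry.
Qed.

(** The threshold [a] balances the signs: the positive part has mean [p (1 + a) = B_E], half the
    mean of the modulus. *)
Let meanX : (\int[P]_w (X w)%:E = 0)%E.
Proof.
have a0 : 0 <= a by have := l0; have := la; lra.
rewrite integral_stop_loss//.
have := integral_normr_stop_loss P mX.
rewrite integral_normX extremal_stop_loss//.
have -> : p * (1 + a - 0) = (1 + l) / 2 by rewrite subr0 -B_E_p_E B_E_val.
case: (stop_loss P (\- X) 0) => [y| |]//.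
rewrite -EFinD -EFinB => -[H]; congr (_ %:E); lra.
Qed.

Definition extremal_RV : {RV P >-> R} := mfun_Sub (mem_set mX).

Lemma extremal_centered : centered_with_E_tail extremal_RV.
Proof.
split.
- exact: iX.
- by rewrite unlock; exact: meanX.
- by move=> t t0; rewrite (tail_normX t0).
Qed.

Lemma extremal_not_cx_le (c : R) : 0 < c -> c < c_E R ->
  ~ cx_le P P extremal_RV (c \*o L).
Proof.
move=> c0 cE; have Ep := @p_E_val R; have Ew := @w_E_val R; have Ec := @c_E_val R.
set C := c_E R in cE Ec *; set w := w_E R in Ew Ec.
have C0 : 0 < C by exact: lt_trans cE.
have w0 : 0 < w by rewrite Ew; have := la; lra.
have wa : w <= a by rewrite Ew; have := l0; lra.
have Cw : C * (1 + w) = 1 + a by rewrite Ec divfK// gt_eqF//; lra.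
(* The tangency point, where the bound for the optimal constant is an equality. It equals
   [1 + a - C], hence is at most [a]. *)
pose u := C * w.
have u0 : 0 <= u by rewrite mulr_ge0// ltW.
have ua : u <= a by rewrite /u; nra.
move=> /(_ _ (convex_hinge u)) H.
have := H (integrable_hinge u0 iX)
  (integrable_hinge u0 (scaled_laplace_integrable c hL)).
rewrite unlock.
rewrite [leLHS](extremal_stop_loss u0 ua) [leRHS](scaled_laplace_stop_loss hL c0 u0).
rewrite lee_fin leNgt => /negP; apply.
have -> : p * (1 + a - u) = C * p by rewrite -Cw /u; ring.
have -> : p = 2^-1 * expR (- w).
  (* The extremal stop-loss at [u] is thus [C / 2 * expR (- w)]. The Laplace side is
     [c / 2 * expR (- (C * w / c))], and [c < C] makes both of its factors strictly smaller. *)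
  have -> : - w = - a + l + l by rewrite Ew; ring.
  by rewrite !expRD expR_ln2 Ep; field.
rewrite mulrA ltr_pM ?divr_ge0 ?expR_ge0 ?(ltW c0)//.
  by rewrite ltr_pM2r.
by rewrite ltr_expR ltrN2 ltr_pdivlMr// mulrC ltr_pM2r.
Qed.

End extremal.

Theorem theorem16 (R : realType)
    (dL : measure_display) (TL : measurableType dL) (PL : probability TL R)
    (L : {RV PL >-> R}) (hL : standard_laplace L) :
  (forall (d : measure_display) (T : measurableType d) (P : probability T R)
      (X : {RV P >-> R}),
    centered_with_E_tail X -> cx_le P PL X (c_E R \*o L)) /\
  (forall c : R, 0 < c -> c < c_E R ->
    exists (d : measure_display) (T : measurableType d) (P : probability T R)
      (X : {RV P >-> R}),
      centered_with_E_tail X /\ ~ cx_le P PL X (c \*o L)).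
Proof.
split=> [d T P X|c c0 cE]; first exact: cx_le_laplace.
(* The counterexample is a function of [L], so it lives on the same probability space and one
   variable serves every [c]. *)
exists dL, TL, PL, (extremal_RV L); split; first exact: extremal_centered.
exact: extremal_not_cx_le.
Qed.
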